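(* An ordered tournament $(H,\sigma)$ is a legend if and only if $H$ is transitive.
   Context: All tournaments are finite. The domination number $\operatorname{dom}(T)$ of a tournament $T$ is the size of the smallest set $X\subseteq V(T)$ such that every vertex in $V(T)\setminus X$ is adjacent from a vertex in $X$ (i.e. is the head of an edge with tail in $X$). An ordered tournament is a pair $(T,\tau)$ where $T$ is a tournament and $\tau$ is a numbering (linear ordering) of $V(T)$; its domination number is $\operatorname{dom}(T)$. An ordered tournament $(T,\tau)$ contains $(H,\sigma)$ if there is an injection $V(H)\to V(T)$ that preserves the direction of all edges and is increasing with respect to the numberings $\sigma$ and $\tau$. An ordered tournament $(H,\sigma)$ is a legend if there exists $k$ such that every ordered tournament $(T,\tau)$ with domination number at least $k$ contains $(H,\sigma)$. A tournament is transitive if it has no directed cycle. *)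

(* Defs.v *)
From mathcomp Require Import all_boot.

Set Implicit Arguments.
Unset Strict Implicit.
Unset Printing Implicit Defensive.

Record tournament := Tournament {
  vertex :> finType;
  edge : rel vertex;
  edge_irrefl : irreflexive edge;
  edge_exactly_one : forall x y : vertex, x != y -> edge x y = ~~ edge y x
}.

(* The numbering is the non-strict linear order [precedes]; its reflexivity
   follows from totality. *)
Record ordered_tournament := OrderedTournament {
  tour :> tournament;
  precedes : rel tour;
  precedes_anti : antisymmetric precedes;
  precedes_trans : transitive precedes;
  precedes_total : total precedes
}.

Definition dominating (T : tournament) (X : {set T}) : bool :=
  [forall y, (y \notin X) ==> [exists x in X, edge x y]].

(* The whole vertex set is dominating, so the minimum is taken over a nonempty
   family. *)
Definition dom (T : tournament) : nat :=
  #|[arg min_(X < [set: T] | dominating X) #|X|]|.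

(* An injective map that is monotone for the non-strict orders is strictly
   increasing. *)
Definition contains (T H : ordered_tournament) : Prop :=
  exists f : H -> T,
    [/\ injective f,
        {homo f : x y / edge x y} &
        {homo f : x y / precedes x y}].

Definition legend (H : ordered_tournament) : Prop :=
  exists k : nat, forall T : ordered_tournament, k <= dom T -> contains T H.

(* [ucycle] also accepts the empty sequence, which is not a directed cycle. *)
Definition transitive_tournament (T : tournament) : Prop :=
  forall c : seq T, ucycle (@edge T) c -> c = [::].

(* Main.v *)
(** If [H] is transitive, cut the ordering of [T] into [#|H|] consecutive
    intervals, none of which can be dominated by few vertices.  Embed the
    vertices of [H] greedily, sinks first: after choosing the image [t] of a
    sink, the in-neighbours of [t] in each remaining interval still cannot be
    dominated by few vertices, since [t] itself dominates the others.

    Conversely, a cyclic triangle whose vertices [a -> b -> c -> a] occur in the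
    order [a, b, c] is avoided as soon as the forward edges form a transitive
    relation; the other orientation is handled by reversing the ordering.
    Ordered tournaments of this kind with large domination number are built by
    putting in front of [T], for each small set [S] of vertices, many new
    vertices whose forward out-neighbourhood is the up-closure of [S].  A small
    set [X] of old vertices is beaten by the new vertices attached to [S = X].
    If [X] also contains new vertices, then it has fewer old ones, and these are
    beaten by an old vertex outside the bounded up-closures attached to the new
    vertices of [X]. *)

Require Import Defs.
From mathcomp Require Import all_boot.

Set Implicit Arguments.
Unset Strict Implicit.
Unset Printing Implicit Defensive.

(** * Edges and transitivity *)

Lemma edge_asym (T : tournament) (x y : T) : edge x y -> edge y x = false.
Proof.
move=> xy; have nxy : y != x.
  by apply: contraTneq xy => ->; rewrite edge_irrefl.
by rewrite (edge_exactly_one nxy) xy.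
Qed.

Lemma edgeNE (T : tournament) (x y : T) : x != y -> ~~ edge x y -> edge y x.
Proof. by move=> nxy; rewrite (edge_exactly_one nxy) negbK. Qed.

Lemma edge_neq (T : tournament) (x y : T) : edge x y -> x != y.
Proof. by apply: contraTneq => ->; rewrite edge_irrefl. Qed.

(** A failure of transitivity closes up to a directed triangle; conversely, transitivity along a
    directed cycle yields a loop. *)
Lemma transitive_tournamentP (T : tournament) :
  transitive_tournament T <-> transitive (@edge T).
Proof.
split=> [Tacyclic b a c ab bc | Ttr [|x p] //= /andP[cyc _]]; last first.
  have : edge x x.
    have := order_path_min Ttr cyc.
    by move/allP/(_ x); apply; rewrite mem_rcons mem_head.
  by rewrite edge_irrefl.
have nac : a != c by apply: contraTneq ab => ->; rewrite edge_asym.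
apply/negPn/negP => /(edgeNE nac) ca.
suff /Tacyclic : ucycle (@edge T) [:: a; b; c] by [].
rewrite /ucycle /= ab bc ca !inE negb_or nac (edge_neq ab).
by rewrite (edge_neq bc).
Qed.

Lemma precedes_refl (T : ordered_tournament) (x : T) : precedes x x.
Proof. by have := precedes_total x x; rewrite orbb. Qed.

(** * Transitive tournaments are legends *)

Section Rank.

Variable T : ordered_tournament.

Definition rank (x : T) := #|[set z : T | (z != x) && precedes z x]|.

Lemma rank_lt_card x : rank x < #|T|.
Proof.
rewrite -cardsT; apply/proper_card/properP; split; first exact: subsetT.
by exists x; rewrite ?inE ?eqxx.
Qed.

Lemma rank_mono x y : x != y -> precedes x y -> rank x < rank y.
Proof.
move=> nxy xy; apply/proper_card/properP; split.
  apply/subsetP=> z; rewrite !inE => /andP[nzx zx].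
  rewrite (precedes_trans zx xy) andbT.
  apply: contraNneq nxy => zy; apply/eqP/precedes_anti.
  by rewrite xy -zy zx.
by exists x; rewrite !inE ?eqxx ?nxy ?xy.
Qed.

Lemma rank_lt_precedes x y : rank x < rank y -> precedes x y.
Proof.
move=> lt; case/orP: (precedes_total x y) => // yx.
have [-> | nyx] := eqVneq y x; first exact: precedes_refl.
by have := rank_mono nyx yx; rewrite ltnNge (ltnW lt).
Qed.

Lemma rank_inj : injective rank.
Proof.
move=> x y exy; apply/eqP; apply/negPn/negP => nxy.
case/orP: (precedes_total x y) => [xy | yx].
  by have := rank_mono nxy xy; rewrite exy ltnn.
by have := rank_mono _ yx; rewrite eq_sym exy ltnn => /(_ nxy).
Qed.

End Rank.

(** * Sets dominated by few vertices *)

Definition coverable (T : tournament) (c : nat) (A : {set T}) : bool :=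
  [exists X : {set T}, (#|X| <= c) &&
    [forall y : T in A, (y \in X) || [exists x in X, edge x y]]].

Section Coverable.

Variable T : tournament.
Implicit Types A B X : {set T}.

Lemma coverableP c A :
  reflect (exists2 X : {set T}, #|X| <= c &
             {in A, forall y, y \notin X -> exists2 x, x \in X & edge x y})
          (coverable c A).
Proof.
apply: (iffP existsP) => [[X /andP[cX /forall_inP XA]] | [X cX XA]]; exists X.
  by [].
  by move=> y /XA; case: (y \in X) => //= /exists_inP.
rewrite cX; apply/forall_inP => y /XA; case: (y \in X) => //= H.
by apply/exists_inP/H.
Qed.

(** The same covering set works for the smaller set, since it may contain vertices outside the set
    it covers. *)
Lemma coverableS c d A B :
  c <= d -> A \subset B -> coverable c B -> coverable d A.
Proof.
move=> cd /subsetP AB /coverableP[X cX XB]; apply/coverableP; exists X.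
  exact: leq_trans cX cd.
by move=> y /AB; apply: XB.
Qed.

Lemma coverableU c d A B :
  coverable c A -> coverable d B -> coverable (c + d) (A :|: B).
Proof.
case/coverableP=> X cX XA /coverableP[Y cY YB]; apply/coverableP.
exists (X :|: Y); first by rewrite (leq_trans (leq_card_setU X Y)) ?leq_add.
move=> y; rewrite !inE negb_or => /orP[yA | yB] /andP[yX yY].
  by have [x xX xy] := XA y yA yX; exists x; rewrite // inE xX.
by have [x xY xy] := YB y yB yY; exists x; rewrite // inE xY orbT.
Qed.

Lemma coverable1 (t : T) : coverable 1 (t |: [set y | edge t y]).
Proof.
apply/coverableP; exists [set t]; first by rewrite cards1.
move=> y; rewrite !inE => /orP[-> // | ty _].
by exists t; rewrite ?inE.
Qed.

Lemma coverable0 c : coverable c (set0 : {set T}).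
Proof. by apply/coverableP; exists set0 => [|y]; rewrite ?cards0 ?inE. Qed.

Lemma dom_coverable k : k < dom T -> ~~ coverable k [set: T].
Proof.
rewrite /dom; case: arg_minnP => [|X _ minX].
  by apply/forallP => y; rewrite inE.
move=> lt; apply/negP => /coverableP[Y cY YT].
have /minX : dominating Y.
  by apply/forallP=> y; apply/implyP=> yY; apply/exists_inP/YT.
by rewrite leqNgt (leq_ltn_trans cY lt).
Qed.

End Coverable.

(** * Cutting the ordering into intervals *)

(** Take the shortest prefix that [c] vertices cannot cover. Without its last vertex it is coverable
    by [c], so the whole prefix is coverable by [c.+1], and the remainder must resist [d]. *)
Lemma uncoverable_prefix (T : ordered_tournament) c d (A : {set T}) :
  ~~ coverable (c.+1 + d) A ->
  exists n, ~~ coverable c [set a in A | rank a < n] /\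
            ~~ coverable d [set a in A | n <= rank a].
Proof.
move=> hA; pose P n := ~~ coverable c [set a in A | rank a < n].
have exP : exists n, P n.
  exists #|T|; apply: contraNN hA; apply: coverableS.
    by rewrite addSnnS leq_addr.
  by apply/subsetP=> a aA; rewrite inE aA rank_lt_card.
case: (ex_minnP exP) => [n Pn minn]; exists n; split=> //.
apply: contra hA => hd.
case: n Pn minn hd => [|n] Pn minn hd.
  case/negP: Pn; apply: coverableS (coverable0 _ c) => //.
  by apply/subsetP=> a; rewrite inE ltn0 andbF.
have cn : coverable c [set a in A | rank a < n].
  by apply: contraT => /minn; rewrite ltnn.
(* Ranks are injective, so at most one vertex has rank [n]. *)
have c1 : coverable 1 [set a : T | rank a == n].
  have [-> | [t]] := set_0Vmem [set a : T | rank a == n].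
    exact: coverable0.
  rewrite inE => /eqP rt.
  apply: coverableS (coverable1 t) => //; apply/subsetP=> a.
  by rewrite !inE -rt => /eqP/rank_inj ->; rewrite eqxx.
rewrite -addn1; apply: coverableS (coverableU (coverableU cn c1) hd) => //.
apply/subsetP=> a aA; rewrite !inE aA /=.
by case: ltngtP.
Qed.

(** Cutting off one interval uses up [c.+1] of the covering budget. *)
Lemma uncoverable_intervals (T : ordered_tournament) c m (A : {set T}) :
  ~~ coverable (m * c.+1) A ->
  exists J : nat -> {set T},
    [/\ forall i, i < m -> J i \subset A,
        forall i, i < m -> ~~ coverable c (J i) &
        forall i j, i < j -> j < m ->
          {in J i & J j, forall a b, precedes a b}].
Proof.
elim: m A => [|m IHm] A; first by exists (fun=> set0).
rewrite mulSn => /uncoverable_prefix[n [hI /IHm[J [JA Jc Jlt]]]].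
exists (fun i => if i is i'.+1 then J i' else [set a in A | rank a < n]).
split.
- case=> [_|i /JA]; last move/subset_trans; last apply.
    by apply/subsetP=> a; rewrite inE => /andP[].
  by apply/subsetP=> a; rewrite inE => /andP[].
- by case=> // i /Jc.
case=> [|i] [|j] // ij jm a b; last exact: Jlt.
rewrite inE => /andP[_ an] /(subsetP (JA j jm)).
rewrite inE => /andP[_ nb]; exact: rank_lt_precedes (leq_trans an nb).
Qed.

(** * Greedy embedding of a transitive tournament *)

(** A vertex with fewest out-neighbours in [S] works: by transitivity, an out-neighbour [w] in [S]
    would have strictly fewer, as [w] itself is lost. *)
Lemma sink_exists (T : tournament) (S : {set T}) :
  transitive (@edge T) -> S != set0 ->
  exists2 v, v \in S & {in S, forall w, ~~ edge v w}.
Proof.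
move=> Ttr /set0Pn[v0 v0S].
pose out v := [set w in S | edge v w].
case: (arg_minnP (fun v => #|out v|) v0S) => v vS minv.
exists v => // w wS; apply/negP => vw.
have := minv w wS; rewrite leqNgt => /negP[].
apply/proper_card/properP; split.
  apply/subsetP=> z; rewrite !inE => /andP[-> wz] /=; exact: Ttr wz.
by exists w; rewrite !inE ?wS ?edge_irrefl.
Qed.

(** Induction on [#|S|]: embedding a sink restricts every other candidate set to in-neighbours of
    its image, which lowers the covering bound by at most one. [t0] is the default value for empty
    [S]. *)
Lemma greedy_embedding (T H : tournament) (t0 : T) (S : {set H})
    (J : H -> {set T}) :
  transitive (@edge H) ->
  {in S, forall x, ~~ coverable #|S|.-1 (J x)} ->
  exists f : H -> T, {in S, forall x, f x \in J x} /\
    {in S &, {homo f : x y / edge x y}}.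
Proof.
move=> Htr; move Dn: #|S| => n.
elim: n S Dn J => [|n IHn] S Dn J /= SJ.
  exists (fun=> t0); have -> : S = set0 by apply/eqP; rewrite -cards_eq0 Dn.
  by split=> x; rewrite inE.
have [|v vS vsink] := sink_exists (S := S) Htr; first by rewrite -card_gt0 Dn.
have [Jv0 | [t tJ]] := set_0Vmem (J v).
  by have := SJ v vS; rewrite Jv0 coverable0.
have DS' : #|S :\ v| = n.
  by apply/eqP; rewrite -eqSS -Dn (cardsD1 v S) vS.
have [x|f [fJ fE]] := IHn _ DS' (fun x => [set y in J x | edge y t]).
  move=> xS'; have n_gt0 : 0 < n by rewrite -DS' (cardD1 x) xS'.
  move: xS'; rewrite !inE => /andP[_ /SJ]; apply: contra => hx.
  (* What the restriction removes from [J x] is covered by [t] alone. *)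
  rewrite -(prednK n_gt0) -addn1.
  apply: coverableS (coverableU hx (coverable1 t)) => //.
  apply/subsetP=> y yJ; rewrite !inE yJ /=.
  have [-> | nyt] := eqVneq y t; first by rewrite orbT.
  by rewrite (edge_exactly_one nyt) orNb.
exists (fun x => if x == v then t else f x); split=> [x xS | x y xS yS xy].
  have [-> // | nxv] := eqVneq x v.
  by have := fJ x; rewrite !inE nxv => /(_ xS) /andP[].
have nxv : x != v by apply: contraTneq xy => ->; apply: vsink.
rewrite (negPf nxv).
have xS' : x \in S :\ v by rewrite !inE nxv.
have [_ | nyv] := eqVneq y v; first by have := fJ x xS'; rewrite inE => /andP[].
by apply: fE => //; rewrite !inE nyv.
Qed.

Lemma transitive_legend (H : ordered_tournament) :
  transitive (@edge H) -> legend H.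
Proof.
(* The product is the budget for [#|H|] intervals, none coverable by [#|H|] vertices; the outer
   successor makes [dom T] exceed it. *)
move=> Htr; exists (#|H| * #|H|.+1).+1 => T /dom_coverable hT.
have [T0 | [t0 _]] := set_0Vmem [set: T].
  by move: hT; rewrite T0 coverable0.
have [J [_ Jc Jlt]] := uncoverable_intervals hT.
(* Each [x] goes into the interval numbered [rank x], so the order is preserved. *)
have [x _|f [fJ fE]] :=
    greedy_embedding (S := setT) (J := fun x => J (rank x)) t0 Htr.
  apply: contra (Jc _ (rank_lt_card x)); apply: coverableS => //.
  by rewrite cardsT leq_pred.
exists f; split=> [x y fxy | x y | x y xy].
(* Distinct vertices are joined by an edge, so equal images would give a loop. *)
- apply/eqP; apply/negPn/negP => nxy.
  have [/fE | /(edgeNE nxy)/fE] := boolP (edge x y); rewrite fxy edge_irrefl.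
    by move=> /(_ (in_setT x) (in_setT y)).
  by move=> /(_ (in_setT y) (in_setT x)).
- by apply: fE.
have [-> | nxy] := eqVneq x y; first exact: precedes_refl.
by apply: (Jlt _ _ (rank_mono nxy xy)) (rank_lt_card y) _ _ _ _; apply: fJ.
Qed.

(** * Legends are transitive *)

Definition forward (T : ordered_tournament) (x y : T) :=
  precedes x y && edge x y.

(** A single forward step reaches the whole closure when [forward] is transitive. *)
Definition up_closure (T : ordered_tournament) (S : {set T}) : {set T} :=
  \bigcup_(s in S) (s |: [set x | forward s x]).

Lemma card_bigcup_le (I T : finType) (A : {set I}) (F : I -> {set T}) b :
  (forall i, i \in A -> #|F i| <= b) -> #|\bigcup_(i in A) F i| <= #|A| * b.
Proof.
move=> Fb; rewrite -sum_nat_const.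
apply: (@leq_trans (\sum_(i in A) #|F i|)); last exact: leq_sum.
elim/big_rec2: _ => [|i B s _ le]; first by rewrite cards0.
by rewrite (leq_trans (leq_card_setU _ _)) // leq_add2l.
Qed.

(** * Adding new vertices in front *)

Section Extension.

Variables (T : ordered_tournament) (n f : nat).

(** With [f.+1] copies for each small set, [f] forbidden vertices cannot exhaust the copies. *)
Definition new_vertex := ({S : {set T} | #|S| <= n} * 'I_f.+1)%type.

Definition new_up (p : new_vertex) : {set T} := up_closure (val p.1).

(** New vertices come first and their mutual edges go backward, so the only forward edges besides
    the old ones lead from a new [p] into [new_up p]. *)
Definition ext_edge (u v : T + new_vertex) : bool :=
  match u, v with
  | inl x, inl y => edge x y
  | inl x, inr q => x \notin new_up q
  | inr p, inl y => y \in new_up p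
  | inr p, inr q => enum_rank q < enum_rank p
  end.

Definition ext_precedes (u v : T + new_vertex) : bool :=
  match u, v with
  | inl x, inl y => precedes x y
  | inl _, inr _ => false
  | inr _, inl _ => true
  | inr p, inr q => enum_rank p <= enum_rank q
  end.

Lemma ext_edge_irrefl : irreflexive ext_edge.
Proof. by case=> [x | p] /=; rewrite ?edge_irrefl ?ltnn. Qed.

Lemma ext_edge_exactly_one u v : u != v -> ext_edge u v = ~~ ext_edge v u.
Proof.
case: u v => [x|p] [y|q] //=.
- by move=> nxy; apply: edge_exactly_one; apply: contraNneq nxy => ->.
- by rewrite negbK.
move=> npq; rewrite -leqNgt ltn_neqAle.
case: eqP => // /val_inj/enum_rank_inj eqp.
by rewrite eqp eqxx in npq.
Qed.

Lemma ext_precedes_anti : antisymmetric ext_precedes.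
Proof.
case=> [x|p] [y|q] //=; first by move/precedes_anti ->.
by rewrite -eqn_leq => /eqP/val_inj/enum_rank_inj ->.
Qed.

Lemma ext_precedes_trans : transitive ext_precedes.
Proof.
case=> [x|p] [y|q] [z|r] //=; first exact: precedes_trans.
exact: leq_trans.
Qed.

Lemma ext_precedes_total : total ext_precedes.
Proof. by case=> [x|p] [y|q] //=; [apply: precedes_total | apply: leq_total]. Qed.

Definition extension : ordered_tournament :=
  @OrderedTournament (Tournament ext_edge_irrefl ext_edge_exactly_one)
    ext_precedes ext_precedes_anti ext_precedes_trans ext_precedes_total.

Lemma extension_forward_trans :
  transitive (@forward T) -> transitive (@forward extension).
Proof.
move=> Ttr [y|q] [x|p] [z|r] //=; rewrite /forward /=.
- exact: Ttr.
(* New, old, old: an up-closure is closed under forward steps by transitivity in [T]. *)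
- case/bigcupP=> s sS ys yz; apply/bigcupP; exists s => //.
  move: ys; rewrite !inE => /orP[/eqP <- | sy]; first by rewrite /forward yz orbT.
  by rewrite (Ttr _ _ _ sy yz) orbT.
- by rewrite leqNgt andNb.
- by rewrite leqNgt andNb.
Qed.

Lemma card_new_up b p :
  (forall x : T, #|[set y | forward x y]| <= b) -> #|new_up p| <= n * b.+1.
Proof.
move=> Tb; apply: (@leq_trans (#|val p.1| * b.+1)).
  by apply: card_bigcup_le => s _; rewrite cardsU1 (leq_add (leq_b1 _) (Tb s)).
by rewrite leq_mul2r (valP p.1) orbT.
Qed.

(** Old vertices gain no forward out-neighbours and new ones reach only [new_up]; the sum bounds
    both cases. *)
Lemma extension_forward_bound b :
  (forall x : T, #|[set y | forward x y]| <= b) ->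
  forall u : extension, #|[set v | forward u v]| <= b + n * b.+1.
Proof.
move=> Tb [x|p].
  apply: leq_trans (leq_addr _ _); apply: leq_trans (Tb x).
  rewrite -(card_imset _ (@inl_inj T new_vertex)); apply: subset_leq_card.
  apply/subsetP=> [[y|q]]; rewrite inE /forward //= => xy.
  by apply: imset_f; rewrite inE.
apply: leq_trans (leq_addl _ _); apply: leq_trans (card_new_up p Tb).
rewrite -(card_imset _ (@inl_inj T new_vertex)); apply: subset_leq_card.
apply/subsetP=> [[y|q]]; rewrite inE /forward /=; first exact: imset_f.
by rewrite leqNgt andNb.
Qed.

End Extension.

(* Tolerating the set [F] of forbidden vertices is what makes the induction on
   [n] go through. *)
Definition unbeaten (T : tournament) (n f : nat) : Prop :=
  forall X F : {set T}, #|X| <= n -> #|F| <= f ->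
    exists2 y, y \notin F & {in X, forall x, edge y x}.

Lemma unbeaten_dom (T : tournament) n f : unbeaten T n f -> n < dom T.
Proof.
move=> Tn; rewrite /dom; case: arg_minnP => [|X domX _].
  by apply/forallP => y; rewrite inE.
rewrite ltnNge; apply/negP => Xn.
have [|y _ yX] := Tn X set0 Xn; first by rewrite cards0.
have yNX : y \notin X by apply/negP => /yX; rewrite edge_irrefl.
have /exists_inP[x xX xy] := implyP (forallP domX y) yNX.
by have := yX x xX; rewrite (edge_asym xy).
Qed.

(** The enlarged allowance makes room for the old part of [F] and for the up-closures of at most
    [n.+1] new vertices, each of size at most [n.+1 * b.+1]. *)
Lemma extension_unbeaten (T : ordered_tournament) n f b :
  (forall x : T, #|[set y | forward x y]| <= b) ->
  unbeaten T n (f + n.+1 * (n.+1 * b.+1)) ->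
  unbeaten (extension T n.+1 f) n.+1 f.
Proof.
move=> Tb Tn X F cX cF.
pose Xold := [set x | inl x \in X]; pose Xnew := [set p | inr p \in X].
pose Fold := [set x | inl x \in F].
have inl_card (A : {set extension T n.+1 f}) :
    inl @: [set x : T | inl x \in A] \subset A.
  by apply/subsetP=> _ /imsetP[x xA ->]; rewrite inE in xA.
have cXnew : #|Xnew| <= n.+1.
  rewrite -(card_imset _ (@inr_inj T (new_vertex T n.+1 f))); apply: leq_trans cX.
  apply/subset_leq_card/subsetP=> _ /imsetP[p pX ->].
  by rewrite inE in pX.
have cFold : #|Fold| <= f.
  rewrite -(card_imset _ (@inl_inj T (new_vertex T n.+1 f))); apply: leq_trans cF.
  exact/subset_leq_card/inl_card.
(* If [X] has only old vertices, a copy attached to [Xold] and outside [F] beats them all. *)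
have [new0 | [p0]] := set_0Vmem Xnew.
  have cXold : #|Xold| <= n.+1.
    rewrite -(card_imset _ (@inl_inj T (new_vertex T n.+1 f))); apply: leq_trans cX.
    exact/subset_leq_card/inl_card.
  pose S : {S : {set T} | #|S| <= n.+1} := Sub Xold cXold.
  pose g (t : 'I_f.+1) : extension T n.+1 f := inr (S, t).
  have g_inj : injective g by move=> t u [].
  have /subsetPn[_ /imsetP[t _ ->] tF] : ~~ (g @: setT \subset F).
    apply/negP => /subset_leq_card; rewrite card_imset // cardsT card_ord.
    by rewrite leqNgt ltnS cF.
  exists (g t) => // [[x|q] qX] /=.
    by apply/bigcupP; exists x; rewrite ?inE ?eqxx.
  by move/setP/(_ q): new0; rewrite !inE qX.
rewrite inE => p0X.
(* Since [p0] is new, at most [n] vertices of [X] are old. An old vertex outside the up-closures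
   beats the new ones. *)
have [||y yF yX] := Tn Xold (Fold :|: \bigcup_(p in Xnew) new_up p).
- rewrite -(card_imset _ (@inl_inj T (new_vertex T n.+1 f))) -ltnS.
  apply: leq_trans cX; apply/proper_card/properP; split; first exact: inl_card.
  by exists (inr p0) => //; apply/imsetP=> [[]].
- rewrite (leq_trans (leq_card_setU _ _)) // leq_add //.
  apply: (@leq_trans (#|Xnew| * (n.+1 * b.+1))).
    by apply: card_bigcup_le => p _; apply: card_new_up.
  by rewrite leq_mul2r cXnew orbT.
move: yF; rewrite !inE negb_or => /andP[yF yup].
exists (inl y) => // [[x|p] xX] /=; first by apply: yX; rewrite inE.
by apply: contra yup => yp; apply/bigcupP; exists p; rewrite ?inE.
Qed.

(** * The base case: a tournament with all edges backward *)

Section Antichain.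

Variable f : nat.

Let antichain_edge (x y : 'I_f.+1) := y < x.

Let antichain_edge_irrefl : irreflexive antichain_edge.
Proof. by move=> x; apply: ltnn. Qed.

Let antichain_edge_exactly_one (x y : 'I_f.+1) :
  x != y -> antichain_edge x y = ~~ antichain_edge y x.
Proof. by move=> nxy; rewrite /antichain_edge -leqNgt ltn_neqAle eq_sym nxy. Qed.

Let antichain_anti : antisymmetric (fun x y : 'I_f.+1 => x <= y).
Proof. by move=> x y; rewrite -eqn_leq => /eqP/val_inj. Qed.

Let antichain_trans : transitive (fun x y : 'I_f.+1 => x <= y).
Proof. by move=> y x z; apply: leq_trans. Qed.

Let antichain_total : total (fun x y : 'I_f.+1 => x <= y).
Proof. by move=> x y; apply: leq_total. Qed.

Definition antichain : ordered_tournament :=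
  @OrderedTournament
    (Tournament antichain_edge_irrefl antichain_edge_exactly_one)
    _ antichain_anti antichain_trans antichain_total.

Lemma antichain_forward (x y : antichain) : forward x y = false.
Proof. by rewrite /forward /= /antichain_edge leqNgt andNb. Qed.

Lemma antichain_unbeaten : unbeaten antichain 0 f.
Proof.
move=> X F; rewrite leqn0 cards_eq0 => /eqP -> cF.
have /subsetPn[y _ yF] : ~~ ([set: antichain] \subset F).
  apply/negP => /subset_leq_card; rewrite cardsT card_ord.
  by rewrite leqNgt ltnS cF.
by exists y => // x; rewrite inE.
Qed.

End Antichain.

(** The bound [b] is chosen before [f] because the inductive step applies the hypothesis to a larger
    [f] that depends on [b]. *)
Lemma forward_transitive_unbeaten n : exists b, forall f,
  exists T : ordered_tournament,
    [/\ transitive (@forward T),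
        forall x : T, #|[set y | forward x y]| <= b &
        unbeaten T n f].
Proof.
elim: n => [|n [b IHn]].
  exists 0 => f; exists (antichain f); split.
  - by move=> y x z; rewrite antichain_forward.
  - move=> x; rewrite leqn0 cards_eq0; apply/eqP/setP=> y.
    by rewrite !inE antichain_forward.
  - exact: antichain_unbeaten.
exists (b + n.+1 * b.+1) => f.
have [T [Ttr Tb Tn]] := IHn (f + n.+1 * (n.+1 * b.+1)).
exists (extension T n.+1 f); split.
- exact: extension_forward_trans.
- exact: extension_forward_bound.
- exact: extension_unbeaten Tn.
Qed.

Lemma forward_transitive_dom k : exists2 T : ordered_tournament,
  transitive (@forward T) & k <= dom T.
Proof.
have [b /(_ 0)[T [Ttr _ Tk]]] := forward_transitive_unbeaten k.
by exists T => //; apply/ltnW/unbeaten_dom/Tk.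
Qed.

(** * Reversal and cyclic triangles *)

Section Reverse.

Variable T : ordered_tournament.

Let rev_anti : antisymmetric (fun x y : T => precedes y x).
Proof. by move=> x y; rewrite andbC; apply: precedes_anti. Qed.

Let rev_trans : transitive (fun x y : T => precedes y x).
Proof. by move=> y x z yx zy; apply: precedes_trans yx. Qed.

Let rev_total : total (fun x y : T => precedes y x).
Proof. by move=> x y; apply: precedes_total. Qed.

Definition reverse : ordered_tournament :=
  @OrderedTournament T _ rev_anti rev_trans rev_total.

End Reverse.

(** In a host with transitive [forward], the images of [a -> b -> c] would force an edge from [f a]
    to [f c], against [c -> a]. *)
Lemma legend_no_increasing_triangle (H : ordered_tournament) (a b c : H) :
  legend H -> edge a b -> edge b c -> edge c a ->
  precedes a b -> ~~ precedes b c.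
Proof.
move=> [k Hk] ab bc ca pab; apply/negP => pbc.
have [T Ttr /Hk[f [_ fE fP]]] := forward_transitive_dom k.
have /Ttr/(_ _) : forward (f a) (f b) by rewrite /forward fE ?fP.
move/(_ (f c)); rewrite /forward fE // fP // => /(_ isT) /andP[_].
by rewrite (edge_asym (fE _ _ ca)).
Qed.

(** Reversing the host instead leaves its domination number unchanged. *)
Lemma legend_reverse (H : ordered_tournament) : legend H -> legend (reverse H).
Proof.
move=> [k Hk]; exists k => T kT; have [f [f_inj fE fP]] := Hk (reverse T) kT.
by exists f; split=> // x y /fP.
Qed.

Lemma legend_no_decreasing_triangle (H : ordered_tournament) (a b c : H) :
  legend H -> edge a b -> edge b c -> edge c a ->
  precedes b a -> ~~ precedes c b.
Proof. by move/legend_reverse; apply: legend_no_increasing_triangle. Qed.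

Lemma legend_transitive (H : ordered_tournament) :
  legend H -> transitive (@edge H).
Proof.
move=> Hleg b a c ab bc.
have nac : a != c by apply: contraTneq ab => ->; rewrite edge_asym.
apply/negPn/negP => /(edgeNE nac) ca.
have inc := legend_no_increasing_triangle Hleg.
have dec := legend_no_decreasing_triangle Hleg.
(* Two of the three comparisons around the cycle agree in direction, and any two are cyclically
   consecutive, so a rotation of the triangle is increasing or decreasing. *)
case/orP: (precedes_total a b) => [pab | pba];
  case/orP: (precedes_total b c) => [pbc | pcb];
  case/orP: (precedes_total c a) => [pca | pac].
- by case/negP: (inc a b c ab bc ca pab).
- by case/negP: (inc a b c ab bc ca pab).
- by case/negP: (inc c a b ca ab bc pca).
- by case/negP: (dec b c a bc ca ab pcb).
- by case/negP: (inc b c a bc ca ab pbc).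
- by case/negP: (dec c a b ca ab bc pac).
- by case/negP: (dec a b c ab bc ca pba).
- by case/negP: (dec a b c ab bc ca pba).
Qed.

Theorem mainTheorem3 (H : ordered_tournament) :
  legend H <-> transitive_tournament H.
Proof.
split=> [/legend_transitive/transitive_tournamentP // |].
by move/transitive_tournamentP/transitive_legend.
Qed.
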